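(* Let $f:[0,\infty)\to[0,\infty)$ be $2$-radical convex. Then for $b>a>0$, $$f\left(\frac{a+b}{2}\right)+\frac{2}{b-a}\int_{0}^{\frac{b-a}{2}}f(x)\,dx\le \frac{1}{b-a}\int_{a}^{b}f(x)\,dx,$$ and $$\frac{1}{b-a}\int_{a}^{b}f(x)\,dx+\frac{1}{b-a}\int_{0}^{\frac{b-a}{2}}\frac{4x f(x)}{\sqrt{(b-a)^2-4x^2}}\,dx\le \frac{f(a)+f(b)}{2}.$$
   Context: Let $p\ge 1$. A continuous function $f:[0,\infty)\to[0,\infty)$ with $f(0)=0$ is called $p$-radical convex if the function $x\mapsto f\left(x^{1/p}\right)$ is convex on $[0,\infty)$. In particular $f$ is $2$-radical convex if $x\mapsto f(\sqrt{x})$ is convex on $[0,\infty)$. *)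

(* Defs.v *)
From HB Require Import structures.
From mathcomp Require Import all_boot all_order all_algebra.
From mathcomp Require Import all_classical all_reals all_analysis.

Set Implicit Arguments.
Unset Strict Implicit.
Unset Printing Implicit Defensive.

Import Order.TTheory GRing.Theory Num.Theory.
Import numFieldNormedType.Exports.

Local Open Scope classical_set_scope.
Local Open Scope ring_scope.

(* A function [0, +oo) -> [0, +oo) is encoded as a total f : R -> R of which
   only the values on [0, +oo) are constrained or used. *)
Definition radical_convex (R : realType) (p : R) (f : R -> R) : Prop :=
  [/\ 1 <= p,
      {within `[0, +oo[, continuous f},
      (forall x, 0 <= x -> 0 <= f x),
      f 0 = 0 &
      convex_function (`[0, +oo[%classic : set R)
        (fun x : R => f (x `^ p^-1))].

(* Main.v *)
(* Put g x = f (sqrt x), which is convex with g 0 = 0, hence superadditive, and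
   let m = (a + b) / 2, h = (b - a) / 2.  Pointwise, for 0 <= u <= h,
     2 f(m) + 2 f(u) <= f(m + u) + f(m - u),
     f(m + u) + f(m - u) + 2 f(sqrt(h^2 - u^2)) <= f(a) + f(b),
   and integrating over u in [0, h] gives both inequalities, the last integral
   of the second one being the image of that of f(sqrt(h^2 - u^2)) under the
   substitution u = sqrt(h^2 - x^2). *)

Require Import Defs.
From HB Require Import structures.
From mathcomp Require Import all_boot all_order all_algebra.
From mathcomp Require Import all_classical all_reals all_analysis.
From mathcomp Require Import measurable_realfun ring lra.

Import Order.TTheory GRing.Theory Num.Theory.
Import numFieldNormedType.Exports.

Local Open Scope classical_set_scope.
Local Open Scope ring_scope.

(** * Convex functions on the half-line *)

Section convex_nonneg.
Variables (R : realType) (g : R -> R).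
Hypothesis cvx_g : forall t x y, 0 <= t <= 1 -> 0 <= x -> 0 <= y ->
  g (t * x + (1 - t) * y) <= t * g x + (1 - t) * g y.

(** Both [x] and [y] are convex combinations of [x + y] and [0], with weights [x / (x + y)] and
    [y / (x + y)] on [x + y]. The terms in [g 0] vanish and these weights sum to 1. *)
Lemma convex_superadditive x y : g 0 = 0 -> 0 <= x -> 0 <= y ->
  g x + g y <= g (x + y).
Proof.
move=> g0 x0 y0; have [xy0|xy0] := eqVneq (x + y) 0.
  have [-> ->] : x = 0 /\ y = 0 by lra.
  by rewrite addr0 g0 addr0.
have s0 : 0 < x + y by rewrite lt_neqAle eq_sym xy0 addr_ge0.
pose t := x / (x + y).
have t0 : 0 <= t by rewrite divr_ge0// ltW.
have t1 : t <= 1 by rewrite ler_pdivrMr// mul1r lerDl.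
have := cvx_g t (x + y) 0; have := cvx_g (1 - t) (x + y) 0.
have -> : (1 - t) * (x + y) + (1 - (1 - t)) * 0 = y by rewrite /t; field.
have -> : t * (x + y) + (1 - t) * 0 = x by rewrite /t; field.
rewrite g0 => /(_ _ _ _)/wrap[||//|Hy]; [lra|exact: ltW|].
move=> /(_ _ _ _)/wrap[||//|Hx]; [lra|exact: ltW|].
lra.
Qed.

(** [P] and its reflection [A + B - P] are convex combinations of [A] and [B] with exchanged
    weights, so adding the two convexity inequalities leaves total weight 1 on each endpoint. *)
Lemma convex_spread A B P : 0 <= A -> A <= P <= B ->
  g P + g (A + B - P) <= g A + g B.
Proof.
move=> A0 /andP[AP PB]; have [AB|AB] := eqVneq A B.
  have PA : P = A by lra.
  by rewrite PA -AB addrK.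
have d0 : 0 < B - A by rewrite subr_gt0 lt_neqAle AB (le_trans AP).
pose t := (P - A) / (B - A).
have t0 : 0 <= t by rewrite divr_ge0 ?subr_ge0// (le_trans AP).
have t1 : t <= 1 by rewrite ler_pdivrMr// mul1r; lra.
have dn0 : B - A != 0 by rewrite gt_eqF.
have := cvx_g t B A; have := cvx_g (1 - t) B A.
have -> : (1 - t) * B + (1 - (1 - t)) * A = A + B - P by rewrite /t; field.
have -> : t * B + (1 - t) * A = P by rewrite /t; field.
move=> /(_ _ _ _)/wrap[||//|HQ]; [lra|lra|].
move=> /(_ _ _ _)/wrap[||//|HP]; [lra|lra|].
lra.
Qed.

End convex_nonneg.

(** * Pointwise inequalities for 2-radical convex functions *)

Section radical2.
Variables (R : realType) (f : R -> R).
Hypothesis hf : radical_convex 2 f.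

Lemma radical2_convex t x y : 0 <= t <= 1 -> 0 <= x -> 0 <= y ->
  f (Num.sqrt (t * x + (1 - t) * y)) <=
  t * f (Num.sqrt x) + (1 - t) * f (Num.sqrt y).
Proof.
move=> /andP[t0 t1] x0 y0; case: hf => _ _ _ _ cf.
have := cf (Itv01 t0 t1) x y.
rewrite !inE/= !in_itv/= !andbT => /(_ x0 y0).
rewrite !convRE /unstable.onem/= !powR12_sqrt//.
by rewrite addr_ge0 ?mulr_ge0 ?subr_ge0.
Qed.

Lemma radical2_superadditive x y z : 0 <= z -> z ^+ 2 = x ^+ 2 + y ^+ 2 ->
  0 <= x -> 0 <= y -> f x + f y <= f z.
Proof.
move=> z0 zE x0 y0.
have [_ _ _ f0 _] := hf.
have := @convex_superadditive R (fun x => f (Num.sqrt x)) radical2_convex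
  (x ^+ 2) (y ^+ 2).
rewrite -zE !sqrtr_sqr !ger0_norm// sqrtr0.
by apply => //; exact: sqr_ge0.
Qed.

(* Convexity at (m^2 + u^2) +- 2mu, then superadditivity at m^2 + u^2 *)
Lemma radical2_midpoint m u : 0 <= u <= m ->
  2 * f m + 2 * f u <= f (m + u) + f (m - u).
Proof.
move=> /andP[u0 um]; have m0 := le_trans u0 um.
set w := Num.sqrt (m ^+ 2 + u ^+ 2).
have wE : w ^+ 2 = m ^+ 2 + u ^+ 2 by rewrite sqr_sqrtr// addr_ge0 ?sqr_ge0.
have := radical2_superadditive m u w; rewrite sqrtr_ge0 wE.
move=> /(_ isT erefl m0 u0) H.
have := @convex_spread R (fun x => f (Num.sqrt x)) radical2_convex
  ((m - u) ^+ 2) ((m + u) ^+ 2) (w ^+ 2) (sqr_ge0 _).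
(* [w ^+ 2] is the midpoint of the two squares, hence its own reflection: the spread inequality
   bounds [2 * f w]. *)
have -> : (m - u) ^+ 2 + (m + u) ^+ 2 - w ^+ 2 = w ^+ 2 by rewrite wE; ring.
rewrite !sqrtr_sqr (ger0_norm (sqrtr_ge0 _)) (@ger0_norm _ (m + u)) ?addr_ge0//.
rewrite (@ger0_norm _ (m - u)) ?subr_ge0// => /(_ _)/wrap[].
  by rewrite wE !expr2; nra.
lra.
Qed.

(* Moving [h^2 - u^2] from each of the two copies onto (m +- u)^2 yields
   m^2 + h^2 +- 2mu, which lies between (m - h)^2 and (m + h)^2. *)
Lemma radical2_endpoint m h u : 0 <= u <= h -> h <= m ->
  f (m + u) + f (m - u) + 2 * f (Num.sqrt (h ^+ 2 - u ^+ 2))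
    <= f (m - h) + f (m + h).
Proof.
move=> /andP[u0 uh] hm.
set s := Num.sqrt _.
have s0 : 0 <= s by exact: sqrtr_ge0.
have sE : s ^+ 2 = h ^+ 2 - u ^+ 2 by rewrite sqr_sqrtr// !expr2; nra.
pose p := Num.sqrt (m ^+ 2 + h ^+ 2 + 2 * m * u).
pose q := Num.sqrt (m ^+ 2 + h ^+ 2 - 2 * m * u).
have pE : p ^+ 2 = m ^+ 2 + h ^+ 2 + 2 * m * u.
  by rewrite sqr_sqrtr// !expr2; nra.
have qE : q ^+ 2 = m ^+ 2 + h ^+ 2 - 2 * m * u.
  by rewrite sqr_sqrtr// !expr2; nra.
have [p0 q0] : 0 <= p /\ 0 <= q by rewrite !sqrtr_ge0.
have Hp := radical2_superadditive (m + u) s p p0.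
have Hq := radical2_superadditive (m - u) s q q0.
have := @convex_spread R (fun x => f (Num.sqrt x)) radical2_convex
  ((m - h) ^+ 2) ((m + h) ^+ 2) (p ^+ 2) (sqr_ge0 _).
have -> : (m - h) ^+ 2 + (m + h) ^+ 2 - p ^+ 2 = q ^+ 2.
  by rewrite pE qE; ring.
rewrite !sqrtr_sqr !ger0_norm//; [|lra..].
move=> /(_ _)/wrap[|H]; first by rewrite pE !expr2; nra.
have {}Hp : f (m + u) + f s <= f p by apply: Hp => //; rewrite ?pE ?sE; [ring|lra].
have {}Hq : f (m - u) + f s <= f q by apply: Hq => //; rewrite ?qE ?sE; [ring|lra].
lra.
Qed.
End radical2.

(** The even extension of [f] is continuous on the whole line, as the integration lemmas below
    require, and agrees with [f] on the half-line. *)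
Lemma continuous_comp_norm (R : realType) (f : R -> R) :
  {within `[0, +oo[, continuous f} -> continuous (fun x : R => f `|x|).
Proof.
move=> /subspace_continuousP cf x.
have nx : [set` `[0, +oo[] `|x| by rewrite /= in_itv/= normr_ge0.
apply: cvg_trans (cf _ nx) => U [e e0 eU].
have := @norm_continuous R R^o x _ (nbhsx_ballx `|x| e e0).
rewrite nbhs_simpl; apply: (@filterS _ (nbhs x)) => y /= yxe.
by apply: eU => //; rewrite /= in_itv/= normr_ge0.
Qed.

Lemma continuous_comp_addl (R : realType) (G : R -> R) (c : R) :
  continuous G -> continuous (fun x : R => G (c + x)).
Proof.
move=> cG x; apply: continuous_comp; last exact: cG.
by apply: (@continuousD _ R^o R^o) => //; exact: cvg_cst.
Qed.

Lemma continuous_comp_subl (R : realType) (G : R -> R) (c : R) :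
  continuous G -> continuous (fun x : R => G (c - x)).
Proof.
move=> cG x; apply: continuous_comp; last exact: cG.
by apply: (@continuousB _ R^o R^o) => //; exact: cvg_cst.
Qed.

(** * Integrals of continuous functions over segments *)

Section integrals.
Variable R : realType.
Implicit Types G : R -> R.
Notation mu := (@lebesgue_measure R).
Local Open Scope ereal_scope.

Lemma continuous_integral_fin_num G (a b : R) : continuous G ->
  \int[mu]_(x in `[a, b]) (G x)%:E \is a fin_num.
Proof.
move=> cG; apply: integrable_fin_num => //.
apply: (@continuous_compact_integrable _ G); first exact: segment_compact.
exact: continuous_subspaceT.
Qed.

Lemma integral_shift G (c a b : R) : continuous G -> (a <= b)%R ->
  \int[mu]_(x in `[(c + a)%R, (c + b)%R]) (G x)%:E =
  \int[mu]_(x in `[a, b]) (G (c + x)%R)%:E.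
Proof.
move=> cG ab.
pose F (x : R) := (c + x)%R.
have D : F^`()%classic = cst 1%R.
  apply/funext => z; rewrite derive1E.
  by rewrite deriveD// derive_cst derive_id add0r.
have cc : continuous F.
  by move=> x; apply: (@continuousD _ R^o R^o) => //; exact: cvg_cst.
rewrite (@integration_by_substitution_increasing _ F G a b ab).
- by apply: eq_integral => x _; rewrite !fctE D mulr1.
- by move=> x y _ _; rewrite ltrD2l.
- by rewrite D => ? _; exact: cvg_cst.
- by rewrite D; exact: is_cvg_cst.
- by rewrite D; exact: is_cvg_cst.
- split => //.
  + by apply: cvg_at_right_filter; exact: cc.
  + by apply: cvg_at_left_filter; exact: cc.
- exact: continuous_subspaceT.
Qed.

(** The segment is split at its centre [m] and the left half is reflected onto the right one. This
    brings the integral over [[a, b]] to the form of the pointwise inequalities. *)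
Lemma integral_fold G (m h : R) : continuous G -> (forall x, 0 <= G x)%R ->
  (0 <= h)%R ->
  \int[mu]_(x in `[(m - h)%R, (m + h)%R]) (G x)%:E =
  \int[mu]_(u in `[0%R, h]) (G (m + u) + G (m - u))%:E.
Proof.
move=> cG G0 h0.
have mG : measurable_fun [set: R] G.
  exact: continuous_measurable_fun.
have c1 := continuous_comp_addl _ _ m cG.
have c2 := continuous_comp_subl _ _ m cG.
under [RHS]eq_integral do rewrite EFinD.
rewrite ge0_integralD//=; first last.
- apply/measurable_funTS/measurable_EFinP; exact: continuous_measurable_fun.
- by move=> x _; rewrite lee_fin.
- apply/measurable_funTS/measurable_EFinP; exact: continuous_measurable_fun.
- by move=> x _; rewrite lee_fin.
have := @integration_by_substitution_oppr R (fun u => G (m + u)%R) 0%R h h0.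
rewrite oppr0 => /(_ _)/wrap[|/= <-]; first exact: continuous_subspaceT.
rewrite addeC -!integral_shift// ?oppr_le0// addr0.
(* The two halves share the point [m]; dropping it from the right half makes the union disjoint. *)
rewrite -[in RHS](@integral_itv_obnd_cbnd R m (BRight (m + h)%R) (EFin \o G)).
  rewrite (@itv_bndbnd_setU _ _ (BLeft (m - h)%R) (BRight m)) ?bnd_simp.
  - rewrite ge0_integral_setU//=.
    + exact/measurable_EFinP/measurable_funTS.
    + by move=> x _; rewrite lee_fin.
    + rewrite disj_set2E; apply/eqP/seteqP; split => x //=.
      by rewrite !in_itv/= => -[/andP[_ xm] /andP[]]; rewrite ltNge xm.
  - by rewrite lerBlDr lerDl.
  - by rewrite lerDl.
exact/measurable_EFinP/measurable_funTS.
Qed.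
End integrals.

(** * Substitution along a quarter circle *)

Section arc.
Variables (R : realType) (h : R).
Hypothesis h0 : 0 < h.
Notation mu := (@lebesgue_measure R).

(** On [[0, h]] the graph is a quarter circle of radius [h], so [F] is a decreasing involution there
    and serves as its own inverse in the substitution. *)
Let F (x : R) : R := Num.sqrt (h ^+ 2 - x ^+ 2).

Let arc_gt0 (x : R) : -h < x < h -> 0 < h ^+ 2 - x ^+ 2.
Proof. by move=> /andP[? ?]; rewrite !expr2; nra. Qed.

Lemma continuous_arc : continuous F.
Proof.
move=> x; have c : {for x, continuous (fun x : R => h ^+ 2 - x ^+ 2)}.
  apply: (@continuousB _ R^o R^o); first exact: cvg_cst.
  exact: exprn_continuous.
exact: (continuous_comp c (@sqrt_continuous R _)).
Qed.

Lemma is_derive_arc (x : R) : -h < x < h -> is_derive x 1 F (- x / F x).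
Proof.
move=> xh; have px := arc_gt0 _ xh.
have D : is_derive x 1 (fun x : R => h ^+ 2 - x ^+ 2) (- (2 * x)).
  by apply: is_derive_eq; rewrite -[_%:A]/(x * 1); ring.
have := @is_derive1_comp R Num.sqrt _ x _ _ (is_derive1_sqrt px) D.
move=> H; apply: is_derive_eq.
rewrite -/(F x); field.
by rewrite gt_eqF// sqrtr_gt0.
Qed.

Let quot (x : R) := x / F x.

Let continuous_quot (x : R) : -h < x < h -> {for x, continuous quot}.
Proof.
move=> xh; apply: (@continuousM R R^o); first exact: cvg_id.
apply: continuousV; last exact: continuous_arc.
by rewrite gt_eqF// sqrtr_gt0 arc_gt0.
Qed.

Let derive_arc (x : R) : -h < x < h -> derive1 F x = - quot x.
Proof.
by move=> /is_derive_arc D; rewrite derive1E derive_val mulNr.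
Qed.

Let continuous_derive_arc (x : R) : -h < x < h -> {for x, continuous (derive1 F : R -> R)}.
Proof.
move=> xh; rewrite /prop_for /continuous_at derive_arc//.
(* The formula for the derivative holds only on the open interval, hence on a neighbourhood of
   [x]. *)
apply: (@cvg_trans _ ((\- quot) @ x)).
  apply: near_eq_cvg.
  have /near_in_itvoo xN : x \in `]-h, h[ by rewrite in_itv.
  near=> y; rewrite derive_arc//.
  have : y \in `]-h, h[ by near: y.
  by rewrite in_itv.
exact: (@continuousN R R^o R^o _ _ (continuous_quot _ xh)).
Unshelve. all: end_near. Qed.

(** The substitution [u = F x] is applied to [G \o F]: since [F (F x) = x] and [- F' = quot], it
    carries the left integral to one over [[F c, h]], which is then enlarged to [[0, h]]. Taking
    [c < h] keeps away from the pole of [quot]. *)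
Lemma integral_arc_le (G : R -> R) (c : R) : continuous G -> (forall x, 0 <= G x) ->
  0 <= c < h ->
  (\int[mu]_(x in `[0%R, c]) (quot x * G x)%:E <=
   \int[mu]_(u in `[0%R, h]) (G (Num.sqrt (h ^+ 2 - u ^+ 2)))%:E)%E.
Proof.
move=> cG G0 /andP[c0 ch].
have cGF : continuous (G \o F).
  by move=> x; apply: continuous_comp; [exact: continuous_arc|exact: cG].
have F0 : F 0 = h by rewrite /F expr0n subr0 sqrtr_sqr gtr0_norm.
have inh x : 0 <= x <= c -> -h < x < h.
  by move=> /andP[x0 xc]; apply/andP; split; lra.
have -> : (\int[mu]_(x in `[0%R, c]) (quot x * G x)%:E =
    \int[mu]_(x in `[F c, F 0]) (G (F x))%:E)%E.
  rewrite (@integration_by_substitution_decreasing R F (G \o F) 0 c c0).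
  - apply: eq_integral => x; rewrite inE/= in_itv/= => xc.
    have xh := inh _ xc; case/andP: xc => x0 xc.
    have FF : F (F x) = x.
      rewrite {1}/F [F x ^+ 2]sqr_sqrtr ?(ltW (arc_gt0 _ xh))//.
      by rewrite opprB addrC subrK sqrtr_sqr ger0_norm.
    by rewrite [in RHS]mulrC !fctE derive_arc// opprK FF.
  - move=> x y; rewrite !in_itv/= => xc yc yx.
    rewrite ltr_sqrt; last exact: arc_gt0 (inh _ _).
    by rewrite !expr2; move: xc yc => /andP[? ?] /andP[? ?]; nra.
  - move=> x; rewrite in_itv/= => /andP[x0 xc].
    by apply: continuous_derive_arc; apply: inh; rewrite !ltW.
  - apply: cvgP; apply: cvg_at_right_filter; apply: continuous_derive_arc.
    by rewrite oppr_lt0 h0.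
  - apply: cvgP; apply: cvg_at_left_filter; apply: continuous_derive_arc.
    by apply: inh; rewrite c0 lexx.
  - split.
    + move=> x; rewrite in_itv/= => /andP[x0 xc].
      by have [] : is_derive x 1 F (- x / F x)
        by apply: is_derive_arc; apply: inh; rewrite !ltW.
    + by apply: cvg_at_right_filter; exact: continuous_arc.
    + by apply: cvg_at_left_filter; exact: continuous_arc.
  - exact: continuous_subspaceT.
rewrite F0; apply: ge0_subset_integral => //=.
- apply/measurable_EFinP/measurable_funTS.
  exact: (continuous_measurable_fun cGF).
- by move=> x _; rewrite lee_fin.
- by apply: subset_itvr; rewrite bnd_simp sqrtr_ge0.
Qed.

(* The substitution is singular at h: pass to the limit from [0, h - 1/(n+1)] *)
Lemma integral_arco_le (G : R -> R) : continuous G -> (forall x, 0 <= G x) ->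
  (\int[mu]_(x in `[0%R, h[) (x / Num.sqrt (h ^+ 2 - x ^+ 2) * G x)%:E <=
   \int[mu]_(u in `[0%R, h]) (G (Num.sqrt (h ^+ 2 - u ^+ 2)))%:E)%E.
Proof.
move=> cG G0.
rewrite itv_bnd_open_bigcup.
have cn n : h - n.+1%:R^-1 < h by rewrite gtrBl invr_gt0.
(* Measurability comes from continuity on an open set, so it is proved on the symmetric interval,
   which contains all the truncated ones. *)
have mq : measurable_fun `]-h, h[ (fun x => quot x * G x).
  apply: open_continuous_measurable_fun => // x; rewrite inE/= in_itv/= => xh.
  by apply: (@continuousM R R^o); [exact: continuous_quot|exact: cG].
have sub n : [set` `[0, h - n.+1%:R^-1]] `<=` [set` `]-h, h[].
  by apply: subset_itv; rewrite bnd_simp ?cn// oppr_lt0.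
have H : (\int[mu]_(x in `[0%R, (h - n.+1%:R^-1)%R]) (quot x * G x)%:E
    @[n --> \oo] --> \int[mu]_(x in \bigcup_n [set` `[0%R, (h - n.+1%:R^-1)%R]])
      (quot x * G x)%:E)%E.
  apply: ge0_nondecreasing_set_cvg_integral => //.
  - move=> n m nm; apply/subsetPset; apply: (@subset_itvl _ R).
    by rewrite bnd_simp lerD2l lerN2 lef_pV2 ?posrE// ler_nat.
  - by move=> n; apply/measurable_EFinP; apply: measurable_funS mq.
  - move=> n x; rewrite /= in_itv/= => /andP[x0 _].
    by rewrite lee_fin mulr_ge0// divr_ge0// sqrtr_ge0.
rewrite -(cvg_lim _ H)//.
apply: lime_le; first exact: cvgP H.
(* For small [n] the bound [h - 1/(n+1)] may be negative; the interval is then empty and its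
   integral is 0. *)
apply: nearW => n; have [n0|n0] := leP 0 (h - n.+1%:R^-1).
  by apply: integral_arc_le => //; rewrite n0 cn.
rewrite set_itv_ge ?bnd_simp -?ltNge// integral_set0.
by apply: integral_ge0 => x _; rewrite lee_fin.
Qed.
End arc.

(** * Integration of the pointwise inequalities *)

Lemma integral_cst_itv (R : realType) (h r : R) : 0 <= h ->
  (\int[lebesgue_measure]_(u in `[0%R, h]) r%:E)%E = (r * h)%:E.
Proof.
move=> h0; rewrite (integral_cst _ _ r%:E)//= lebesgue_measure_itv/= lte_fin.
case: ltgtP h0 => // [_|<-] _; last by rewrite mule0 mulr0.
by rewrite oppr0 adde0 EFinM.
Qed.

(* Integrals are Lebesgue integrals of nonnegative functions, valued in
   [0, +oo].  The singular endpoint x = (b - a) / 2 is left out of the domain of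
   the last one, where the integrand would be a division by zero. *)
Theorem theorem2p2 (R : realType) (f : R -> R) (a b : R)
    (hf : radical_convex 2 f) (ha : 0 < a) (hab : a < b) :
  ((f ((a + b) / 2))%:E
     + (2 / (b - a))%:E
       * \int[lebesgue_measure]_(x in `[0%R, ((b - a) / 2)%R]) (f x)%:E
   <= (b - a)^-1%:E * \int[lebesgue_measure]_(x in `[a, b]) (f x)%:E)%E
  /\
  ((b - a)^-1%:E * \int[lebesgue_measure]_(x in `[a, b]) (f x)%:E
     + (b - a)^-1%:E
       * \int[lebesgue_measure]_(x in `[0%R, ((b - a) / 2)%R[)
           (4 * x * f x / Num.sqrt ((b - a) ^+ 2 - 4 * x ^+ 2))%:E
   <= ((f a + f b) / 2)%:E)%E.
Proof.
have [_ cf f0 _ _] := hf.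
set m := (a + b) / 2; set h := (b - a) / 2.
have h0 : 0 < h by rewrite /h; lra.
have hm : h < m by rewrite /h /m; lra.
have aE : a = m - h by rewrite /m /h; field.
have bE : b = m + h by rewrite /m /h; field.
have baE : b - a = 2 * h by rewrite /h; field.
clearbody m h; subst a b; rewrite baE.
(* f is only continuous on [0, +oo[ ; k agrees with it there *)
pose k (x : R) : R := f `|x|.
have ck : continuous k by exact: continuous_comp_norm.
have k0 x : 0 <= k x by exact: f0.
have kE x : 0 <= x -> k x = f x by move=> x0; rewrite /k ger0_norm.
have -> : (\int[lebesgue_measure]_(x in `[0%R, h]) (f x)%:E =
    \int[lebesgue_measure]_(x in `[0%R, h]) (k x)%:E)%E.
  apply: eq_integral => x; rewrite inE/= in_itv/= => /andP[x0 _].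
  by rewrite kE.
have -> : (\int[lebesgue_measure]_(x in `[(m - h)%R, (m + h)%R]) (f x)%:E =
    \int[lebesgue_measure]_(x in `[(m - h)%R, (m + h)%R]) (k x)%:E)%E.
  apply: eq_integral => x; rewrite inE/= in_itv/= => /andP[x0 _].
  by rewrite kE//; lra.
have -> : (\int[lebesgue_measure]_(x in `[0%R, h[)
      (4 * x * f x / Num.sqrt ((2 * h) ^+ 2 - 4 * x ^+ 2))%:E =
    \int[lebesgue_measure]_(x in `[0%R, h[)
      (x / Num.sqrt (h ^+ 2 - x ^+ 2) * (2 * k x))%:E)%E.
  apply: eq_integral => x; rewrite inE/= in_itv/= => /andP[x0 xh].
  (* The factor 4 leaves the root as 2 and cancels half of the leading 4; the other 2 is absorbed
     into [2 * k x]. *)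
  have -> : (2 * h) ^+ 2 - 4 * x ^+ 2 = 2 ^+ 2 * (h ^+ 2 - x ^+ 2) by ring.
  rewrite sqrtrM ?sqr_ge0// sqrtr_sqr ger0_norm// kE//; congr _%:E.
  field; rewrite gt_eqF// sqrtr_gt0 !expr2; nra.
have c2k : continuous (fun x : R => 2 * k x : R).
  by move=> x; apply: (@continuousM R R (cst 2)); [exact: cvg_cst|exact: ck].
(* The singular integral has to be bounded only from above, so an inequality can stand in for the
   exact change of variables. *)
have := integral_arco_le R h h0 (fun x => 2 * k x) c2k.
move=> /(_ _)/wrap[x|TL]; first by rewrite mulr_ge0.
have cplus : continuous (fun u : R => k (m + u) + k (m - u) : R).
  have c1 := continuous_comp_addl _ _ m ck.
  have c2 := continuous_comp_subl _ _ m ck.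
  by move=> x; exact: (continuousD (c1 x) (c2 x)).
have carc : continuous (fun u : R => 2 * k (Num.sqrt (h ^+ 2 - u ^+ 2)) : R).
  by move=> x; exact: (continuous_comp (continuous_arc R h x) (c2k _)).
have SE := integral_fold R k m h ck k0 (ltW h0).
have mfin (g : R -> R) : continuous g ->
    measurable_fun [set` `[0, h]] (EFin \o g).
  move=> cg; apply/measurable_EFinP/measurable_funTS.
  exact: (continuous_measurable_fun cg).
(* The midpoint inequality integrated over [[0, h]], against the folded integral of [k]. *)
have low : ((2 * f m * h)%:E
    + 2%:E * \int[lebesgue_measure]_(x in `[0%R, h]) (k x)%:E <=
    \int[lebesgue_measure]_(x in `[(m - h)%R, (m + h)%R]) (k x)%:E)%E.
  rewrite SE -(integral_cst_itv _ _ _ (ltW h0)) -ge0_integralZl_EFin//; first last.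
  - exact: mfin.
  - by move=> x _; rewrite lee_fin.
  rewrite -ge0_integralD//; first last.
  - exact: mfin c2k.
  - by move=> x _; rewrite lee_fin mulr_ge0.
  - by move=> x _; rewrite lee_fin mulr_ge0// f0// (le_trans (ltW h0))// ltW.
  apply: ge0_le_integral => //.
  - move=> x _; rewrite adde_ge0// lee_fin mulr_ge0//.
    by rewrite f0// (le_trans (ltW h0))// ltW.
  - by apply: emeasurable_funD; [exact: measurable_cst|exact: mfin c2k].
  - exact: mfin.
  - move=> x; rewrite /= in_itv/= => /andP[x0 xh].
    rewrite -EFinM -EFinD lee_fin !kE//; [|lra..].
    by apply: radical2_midpoint => //; lra.
(* The endpoint inequality integrated over [[0, h]]; its constant right-hand side produces the
   factor [h]. *)
have up : (\int[lebesgue_measure]_(x in `[(m - h)%R, (m + h)%R]) (k x)%:E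
    + \int[lebesgue_measure]_(u in `[0%R, h])
        (2 * k (Num.sqrt (h ^+ 2 - u ^+ 2)))%:E
    <= ((f (m - h) + f (m + h)) * h)%:E)%E.
  rewrite SE -(integral_cst_itv _ _ _ (ltW h0)) -ge0_integralD//; first last.
  - exact: mfin carc.
  - by move=> x _; rewrite lee_fin mulr_ge0.
  - exact: mfin cplus.
  - by move=> x _; rewrite lee_fin addr_ge0.
  apply: ge0_le_integral => //.
  - by move=> x _; rewrite lee_fin !addr_ge0// mulr_ge0.
  - by apply: emeasurable_funD; [exact: mfin cplus|exact: mfin carc].
  - move=> x; rewrite /= in_itv/= => /andP[x0 xh].
    rewrite -EFinD lee_fin !kE ?sqrtr_ge0//; [|lra..].
    by apply: radical2_endpoint => //; lra.
(* Integrals of continuous functions over segments are finite, so [low] and [up] become inequalities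
   between reals. The singular integral stays extended-valued and enters only through [TL]. *)
have /fineK := continuous_integral_fin_num R k (m - h) (m + h) ck.
have /fineK := continuous_integral_fin_num R k 0 h ck.
have /fineK := continuous_integral_fin_num R _ 0 h carc.
move: low up TL => + + + Lf Jf Sf.
rewrite -{}Lf -{}Jf -{}Sf.
set J := fine _; set S := fine _; set L := fine _.
rewrite -EFinM -!EFinD !lee_fin => low up TL.
split.
  rewrite -(ler_pM2l (_ : 0 < 2 * h)) ?mulr_gt0//.
  rewrite mulrDr !mulrA !mulfV ?mul1r ?gt_eqF ?mulr_gt0//.
  have -> : 2 * h * 2 / (2 * h) = 2 by field; rewrite gt_eqF.
  lra.
apply: (@le_trans _ _ ((2 * h)^-1%:E * S%:E + (2 * h)^-1%:E * L%:E)%E).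
  by rewrite leeD2l// lee_pmul2l// ?lte_fin ?invr_gt0 ?mulr_gt0.
rewrite -!EFinM -EFinD lee_fin -mulrDr mulrC ler_pdivrMr ?mulr_gt0//.
lra.
Qed.
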